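(* Assume that $f_1,f_2$ satisfy Assumption (A) of the context, and let $(\tilde X_{t_i})$ be the Lie–Trotter splitting approximation defined in the context, with initial condition $x_0\in\mathbb{R}^\kappa$. Then for all $i$, $k\in\{1,2\}$ and $j\in\{1,\dots,\eta_k+1\}$, $$\tilde{\mathcal{I}}^{k,j}_{\min}\le\mathbb{E}[\tilde X^{k,j}_{t_i}]\le\tilde{\mathcal{I}}^{k,j}_{\max},$$ where $$\tilde{\mathcal{I}}^{k,j}_{\min}=\left(e^{At_i}x_0\right)^{k,j}+\Delta\sum_{l=0}^{i}e^{-\nu_kt_l}\,t_l^{\eta_k+1-j}\min\left\{0,\frac{c_kf^{\max}_{k+1}}{(\eta_k+1-j)!}\right\},$$ $$\tilde{\mathcal{I}}^{k,j}_{\max}=\left(e^{At_i}x_0\right)^{k,j}+\Delta\sum_{l=0}^{i}e^{-\nu_kt_l}\,t_l^{\eta_k+1-j}\max\left\{0,\frac{c_kf^{\max}_{k+1}}{(\eta_k+1-j)!}\right\}.$$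
   Context: Parameters: integers $\eta_1,\eta_2\ge1$, reals $\nu_1,\nu_2>0$, $c_1,c_2\in\{-1,+1\}$, $\kappa=\eta_1+\eta_2+2$, an integer $N\ge1$, and $p_1,p_2>0$ with $p_1+p_2=1$. The index $k\in\{1,2\}$ is cyclic (index $3$ means $1$). Convention: $0^0=1$. Assumption (A): $f_1,f_2:\mathbb{R}\to\mathbb{R}$ are Lipschitz continuous, non-decreasing, and $0<f_k\le f_k^{\max}<\infty$ for $k=1,2$. A vector $x\in\mathbb{R}^\kappa$ is written $x=(x^1,x^2)$ with $x^k=(x^{k,1},\dots,x^{k,\eta_k+1})\in\mathbb{R}^{\eta_k+1}$. $A\in\mathbb{R}^{\kappa\times\kappa}$ is block-diagonal with blocks $A_{\nu_1},A_{\nu_2}$, where $A_{\nu_k}$ is the $(\eta_k+1)\times(\eta_k+1)$ matrix with $-\nu_k$ on the diagonal, $1$ on the first superdiagonal and $0$ elsewhere. $B:\mathbb{R}^\kappa\to\mathbb{R}^\kappa$ has all components zero except $(B(x))^{1,\eta_1+1}=c_1f_2(x^{2,1})$ and $(B(x))^{2,\eta_2+1}=c_2f_1(x^{1,1})$; $\sigma:\mathbb{R}^\kappa\to\mathbb{R}^{\kappa\times2}$ has all entries zero except the entry in row $(1,\eta_1+1)$, column $2$, equal to $\frac{c_1}{\sqrt{p_2}}\sqrt{f_2(x^{2,1})}$, and the entry in row $(2,\eta_2+1)$, column $1$, equal to $\frac{c_2}{\sqrt{p_1}}\sqrt{f_1(x^{1,1})}$. Lie–Trotter splitting scheme with time step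 $\Delta>0$ and $t_i=i\Delta$, $i=0,1,\dots,i_{\max}$: $\tilde X_{t_0}=x_0$ and $$\tilde X_{t_{i+1}}=e^{A\Delta}\left(\tilde X_{t_i}+\Delta B(\tilde X_{t_i})+\frac{\sqrt\Delta}{\sqrt N}\sigma(\tilde X_{t_i})\xi_i\right),$$ where the $\xi_i=(\xi_i^1,\xi_i^2)^T$ are i.i.d. 2-dimensional standard normal vectors. *)

(* Defs.v *)
From HB Require Import structures.
From mathcomp Require Import all_boot all_order all_algebra.
From mathcomp Require Import all_classical all_reals all_analysis.
Set Implicit Arguments.
Unset Strict Implicit.
Unset Printing Implicit Defensive.
Import Order.TTheory GRing.Theory Num.Theory.
Import numFieldNormedType.Exports.
Local Open Scope classical_set_scope.
Local Open Scope ring_scope.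

(* The populations k = 1, 2 are the elements 0, 1 of 'I_2, and the cyclic
   successor k + 1 is [ordS k].  The coordinate x^(k,j) with
   1 <= j <= eta_k + 1 has the 0-based index j - 1 : 'I_(eta k).+1, so that
   eta_k + 1 - j becomes [eta k - j]. *)
Notation kappa eta := (\sum_(k < 2) (eta k).+1)%N.

Definition block_coord (R : Type) (eta : 'I_2 -> nat) (x : 'cV[R]_(kappa eta))
    (k : 'I_2) (j : 'I_(eta k).+1) : R :=
  submxcol x k j ord0.

Definition expmx (R : realType) (n : nat) (M : 'M[R]_n) : 'M[R]_n :=
  limn (series (fun m => m`!%:R^-1 *: M ^+ m)).

Definition drift_block (R : realType) (n : nat) (nu : R) : 'M[R]_n :=
  \matrix_(i < n, j < n)
    if i == j then - nu else if (j == i.+1 :> nat) then 1 else 0.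

Definition drift_mx (R : realType) (eta : 'I_2 -> nat) (nu : 'I_2 -> R) :
    'M[R]_(kappa eta) :=
  \mxdiag_(k < 2) drift_block (eta k).+1 (nu k).

Definition drift_fun (R : realType) (eta : 'I_2 -> nat) (c : 'I_2 -> R)
    (f : 'I_2 -> R -> R) (x : 'cV[R]_(kappa eta)) : 'cV[R]_(kappa eta) :=
  \mxcol_(k < 2) \col_(j < (eta k).+1)
    if j == ord_max then c k * f (ordS k) (block_coord x (k := ordS k) ord0) else 0.

Definition diffusion (R : realType) (eta : 'I_2 -> nat) (c p : 'I_2 -> R)
    (f : 'I_2 -> R -> R) (x : 'cV[R]_(kappa eta)) : 'M[R]_(kappa eta, 2) :=
  \mxcol_(k < 2) \matrix_(j < (eta k).+1, m < 2)
    if (j == ord_max) && (m == ordS k)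
    then c k / Num.sqrt (p (ordS k)) *
         Num.sqrt (f (ordS k) (block_coord x (k := ordS k) ord0))
    else 0.

Definition assumptionA (R : realType) (f : 'I_2 -> R -> R)
    (fmax : 'I_2 -> R) : Prop :=
  forall k : 'I_2,
    [/\ [lipschitz f k x | x in [set: R]],
        {homo f k : x y / x <= y}
      & forall x, 0 < f k x <= fmax k].

Definition col2 (R : Type) (z : R * R) : 'cV[R]_2 :=
  \col_(m < 2) if m == ord0 then z.1 else z.2.

Definition standard_normal2 (d : measure_display) (T : measurableType d)
    (R : realType) (P : probability T R)
    (Z : {RV P >-> (R * R)%type}) : Prop :=
  forall U : set (R * R), measurable U ->
    distribution P Z U = (normal_prob 0 1 \x normal_prob 0 1)%E U.

Definition independent_RVs (d d' : measure_display) (T : measurableType d)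
    (T' : measurableType d') (R : realType) (P : probability T R)
    (I : finType) (Z : I -> {RV P >-> T'}) : Prop :=
  forall (J : {set I}) (U : I -> set T'), (forall i, measurable (U i)) ->
    P (\bigcap_(i in [set` J]) Z i @^-1` U i) =
    (\prod_(i in J) P (Z i @^-1` U i))%E.

Definition lie_trotter_step (R : realType) (eta : 'I_2 -> nat)
    (nu c p : 'I_2 -> R) (N : nat) (f : 'I_2 -> R -> R) (Delta : R)
    (x : 'cV[R]_(kappa eta)) (z : 'cV[R]_2) : 'cV[R]_(kappa eta) :=
  expmx (Delta *: drift_mx eta nu) *m
    (x + Delta *: drift_fun c f x
       + (Num.sqrt Delta / Num.sqrt N%:R) *: (diffusion c p f x *m z)).

Definition lie_trotter_scheme (R : realType) (T : Type) (eta : 'I_2 -> nat)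
    (nu c p : 'I_2 -> R) (N : nat) (f : 'I_2 -> R -> R) (Delta : R)
    (x0 : 'cV[R]_(kappa eta)) (imax : nat) (xi : 'I_imax -> T -> R * R)
    (X : nat -> T -> 'cV[R]_(kappa eta)) : Prop :=
  (forall w, X 0%N w = x0) /\
  (forall (i : 'I_imax) w,
     X i.+1 w = lie_trotter_step nu c p N f Delta (X i w) (col2 (xi i w))).

(* [opt] is [Num.min] for the lower bound and [Num.max] for the upper one. *)
Definition mean_bound (R : realType) (opt : R -> R -> R) (eta : 'I_2 -> nat)
    (nu c fmax : 'I_2 -> R) (Delta : R) (x0 : 'cV[R]_(kappa eta)) (i : nat)
    (k : 'I_2) (j : 'I_(eta k).+1) : R :=
  let t (l : nat) : R := l%:R * Delta in
  block_coord (expmx (t i *: drift_mx eta nu) *m x0) j +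
  Delta * \sum_(0 <= l < i.+1)
    expR (- nu k * t l) * t l ^+ (eta k - j) *
    opt 0 (c k * fmax (ordS k) / (eta k - j)`!%:R).

(* Main.v *)
Require Import Defs.
From HB Require Import structures.
From mathcomp Require Import all_boot all_order all_algebra.
From mathcomp Require Import all_classical all_reals all_analysis.
From mathcomp Require Import measurable_realfun.
From mathcomp Require Import ring lra zify.
Set Implicit Arguments.
Unset Strict Implicit.
Unset Printing Implicit Defensive.
Import Order.TTheory GRing.Theory Num.Theory.
Import numFieldNormedType.Exports.
Local Open Scope classical_set_scope.
Local Open Scope ring_scope.

(* The exponential of [s *: drift_mx] is block diagonal, with upper triangular
   Toeplitz blocks of entries e^(-nu s) s^(l-j) / (l-j)!, which are nonnegative
   for s >= 0 and form a semigroup in s.  The state at step i is measurable with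
   respect to the sigma-algebra generated by the noises of index < i, hence
   independent of the i-th noise, so that the diffusion term has mean zero and
   the vector of means solves m_(i+1) = e^(A Delta) (m_i + Delta E[B(X_i)]).
   The only nonzero entry of E[B(X_i)] in block k lies between
   min(0, c_k fmax_(k+1)) and max(0, c_k fmax_(k+1)); by nonnegativity of
   e^(A Delta) the means lie between the solutions of the recursions forced by
   these two constants, which the semigroup property makes explicit. *)

(** * The matrix exponential of the drift, computed entrywise *)

Lemma cvg_mx (R : realType) (m n : nat) (u : nat -> 'M[R]_(m, n))
    (M : 'M[R]_(m, n)) :
  (forall i j, (fun l => u l i j) @ \oo --> M i j) -> u @ \oo --> M.
Proof.
move=> cvgu A [B nbhsB subBA].
have : \forall l \near \oo, forall i j, B i j (u l i j).
  apply: filter_forall => i; apply: filter_forall => j.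
  exact: (cvgu i j).
by apply: filterS => l Bul; exact: subBA.
Qed.

(** [expmx] is a [limn], so its value is usable only once convergence is known. Matrix convergence
    is entrywise, and limits are unique because the space is Hausdorff. *)
Lemma expmxP (R : realType) (n : nat) (M E : 'M[R]_n) :
  (forall i j, series (fun m => m`!%:R^-1 * (M ^+ m) i j) @ \oo --> E i j) ->
  expmx M = E.
Proof.
move=> cvgE; apply: cvg_lim; first exact: norm_hausdorff.
apply: cvg_mx => i j; have := cvgE i j; apply: cvg_trans.
apply: near_eq_cvg; near=> l.
rewrite /series /= summxE; apply: eq_bigr => k _.
by rewrite mxE.
Unshelve. all: by end_near. Qed.

(** A drift block is -nu times the identity plus the nilpotent shift. The two commute, so the
    exponential is e^(-nu s) times the exponential series of the shift, whose d-th power sits on the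
    d-th superdiagonal. The guard matters because [j - i] truncates to 0 below the diagonal. *)
Definition shift_exp (R : realType) (n : nat) (nu s : R) : 'M[R]_n :=
  \matrix_(i < n, j < n)
    if (i <= j)%N then expR (- nu * s) * s ^+ (j - i) / (j - i)`!%:R else 0.

(** Binomial theorem for the identity part and the shift part: at entry (i, j) only the term of
    shift degree j - i survives. If j - i exceeds m, the binomial coefficient is zero. *)
Lemma drift_block_expE (R : realType) (n m : nat) (nu s : R) (i j : 'I_n) :
  ((s *: drift_block n nu) ^+ m) i j =
    if (i <= j)%N then 'C(m, j - i)%:R * (- nu * s) ^+ (m - (j - i)) * s ^+ (j - i)
    else 0.
Proof.
elim: m i j => [|m IHm] i j.
  rewrite expr0 mxE bin0n sub0n expr0 mulr1.
  have [->|neq_ij] := eqVneq i j; first by rewrite leqnn subnn eqxx expr0 mulr1.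
  case: leqP => // le_ij; have -> : (j - i == 0)%N = false.
    by rewrite subn_eq0 leqNgt ltn_neqAle le_ij andbT neq_ij.
  by rewrite mul0r.
rewrite exprS -mulmxE mxE (bigD1 i) //= !mxE eqxx IHm.
(* Row [i] is nonzero only in columns [i] and [i.+1], and the last row only on the diagonal. *)
have [lt_in|ge_in] := ltnP i.+1 n; last first.
  rewrite big1 ?addr0 => [|k neq_ki].
    case: leqP => [le_ij|]; last by rewrite mulr0.
    have -> : (j - i = 0)%N by have := ltn_ord j; lia.
    rewrite !bin0 !subn0 exprS; ring.
  rewrite !mxE eq_sym (negPf neq_ki); case: eqP => [eq_ki|]; last by rewrite mulr0 mul0r.
  by have := ltn_ord k; lia.
pose i' := Ordinal lt_in.
rewrite (bigD1 i') /=; last by apply/eqP => /(congr1 val) /=; lia.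
rewrite !mxE eqxx IHm /= big1 ?addr0 => [|k /andP[neq_ki neq_ki']]; last first.
  rewrite !mxE eq_sym (negPf neq_ki); case: eqP => [eq_ki|]; last by rewrite mulr0 mul0r.
  by move: neq_ki'; rewrite -val_eqE /= eq_ki eqxx.
have -> : (i == i' :> 'I_n) = false by apply/eqP => /(congr1 val) /=; lia.
case: (ltngtP i j) => [lt_ij|lt_ji|eq_ij].
(* Pascal's rule; the cases e < m, m < e and m = e differ in how [m - e] and [m - e.+1] truncate. *)
- rewrite -(subnSK lt_ij) binS subSS; set e := (j - i.+1)%N.
  case: (leqP e.+1 m) => [le_em|lt_me].
    have -> : (m - e = (m - e.+1).+1)%N by lia.
    rewrite natrD !exprS; ring.
  rewrite (bin_small lt_me) add0n.
  have [lt_me'|le_em] := ltnP m e; first by rewrite bin_small //; ring.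
  have -> : m = e by lia.
  rewrite !binn subnn !expr0 exprS; ring.
- by rewrite !mulr0 addr0.
- rewrite -eq_ij subnn !bin0 !subn0 expr0 exprS; ring.
Qed.

(** The terms with m < d vanish, and for m >= d one has C(m, d) / m! = 1 / (d! (m - d)!). Shifting
    the partial sums by d therefore leaves the exponential series of [a] divided by d!. *)
Lemma cvg_series_exp_shift (R : realType) (a : R) (d : nat) :
  series (fun m => m`!%:R^-1 * ('C(m, d)%:R * a ^+ (m - d))) @ \oo -->
    expR a / d`!%:R.
Proof.
rewrite -(cvg_shiftn d).
have -> : (fun n => series (fun m => m`!%:R^-1 * ('C(m, d)%:R * a ^+ (m - d))) (n + d)) =
    (fun n => series (exp_coeff a) n / d`!%:R).
  apply/funext => n; rewrite /series /= (@big_cat_nat _ _ _ d) ?leq_addl //=.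
  rewrite big_nat big1 ?add0r => [|m /andP[_ lt_md]]; last first.
    by rewrite bin_small // mul0r mulr0.
  rewrite -{1}[d]add0n big_addn addnK mulr_suml; apply: eq_bigr => m _.
  rewrite addnK -(@bin_fact (m + d) d) ?leq_addl // addnK !natrM /exp_coeff /=.
  have C0 : 'C(m + d, d)%:R != 0 :> R.
    by rewrite pnatr_eq0 -lt0n bin_gt0 leq_addl.
  have d0 : d`!%:R != 0 :> R by rewrite pnatr_eq0 -lt0n fact_gt0.
  have m0 : m`!%:R != 0 :> R by rewrite pnatr_eq0 -lt0n fact_gt0.
  by field; rewrite C0 d0 m0.
by apply: cvgM; [exact: is_cvg_series_exp_coeff|exact: cvg_cst].
Qed.

Lemma mxdiag_exp (R : pzRingType) (p : nat) (q : 'I_p -> nat)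
    (D : forall i, 'M[R]_(q i)) (m : nat) :
  (\mxdiag_i D i) ^+ m = \mxdiag_i ((D i) ^+ m).
Proof.
elim: m => [|m IHm]; first by rewrite expr0 -[1]/(1%:M) -mxdiagZ.
rewrite exprS IHm -mulmxE [X in _ *m X]/mxdiag mul_mxdiag_mxblock; apply: eq_mxblock => i j.
by case: eqVneq => [<-|]; rewrite ?conform_mx_id ?mulmx0 // exprS mulmxE.
Qed.

Lemma scale_mxdiag (R : pzRingType) (p : nat) (q : 'I_p -> nat)
    (D : forall i, 'M[R]_(q i)) (a : R) :
  a *: (\mxdiag_i D i) = \mxdiag_i (a *: D i).
Proof.
rewrite -mul_scalar_mx -mxdiagZ [X in _ *m X]/mxdiag mul_mxdiag_mxblock; apply: eq_mxblock => i j.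
by case: eqVneq => [<-|]; rewrite ?conform_mx_id ?mulmx0 // mul_scalar_mx.
Qed.

Lemma mxdiagE (V : nmodType) (p : nat) (q : 'I_p -> nat)
    (D : forall i, 'M[V]_(q i)) (i j : 'I_(\sum_i q i)) :
  (\mxdiag_i D i) i j =
    (if tagnat.sig1 i == tagnat.sig1 j then conform_mx 0 (D (tagnat.sig1 i)) else 0)
      (tagnat.sig2 i) (tagnat.sig2 j).
Proof. by rewrite !mxE. Qed.

Lemma cvg_series_eq0 (R : realType) (u : nat -> R) :
  (forall m, u m = 0) -> series u @ \oo --> 0.
Proof.
move=> u0; rewrite (_ : series u = fun=> 0); first exact: cvg_cst.
by apply/funext => n; rewrite /series /= big1.
Qed.

Lemma cvg_series_drift_block (R : realType) (n : nat) (nu s : R) (i j : 'I_n) :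
  series (fun m => m`!%:R^-1 * ((s *: drift_block n nu) ^+ m) i j) @ \oo -->
    shift_exp n nu s i j.
Proof.
rewrite mxE; case: leqP => [le_ij|lt_ji]; last first.
  apply: cvg_series_eq0 => m.
  by rewrite drift_block_expE leqNgt lt_ji mulr0.
set e := (j - i)%N.
rewrite [X in X @ _ --> _](_ : _ = (fun l =>
    series (fun m => m`!%:R^-1 * ('C(m, e)%:R * (- nu * s) ^+ (m - e))) l * s ^+ e)).
  by rewrite mulrAC; apply: cvgM; [exact: cvg_series_exp_shift|exact: cvg_cst].
apply/funext => l; rewrite /series /= mulr_suml; apply: eq_bigr => m _.
by rewrite drift_block_expE le_ij /e; ring.
Qed.

Lemma expmx_drift (R : realType) (eta : 'I_2 -> nat) (nu : 'I_2 -> R) (s : R) :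
  expmx (s *: drift_mx eta nu) = \mxdiag_k shift_exp (eta k).+1 (nu k) s.
Proof.
apply: expmxP => i j.
rewrite (_ : (fun m => _) = fun m => m`!%:R^-1 *
    (\mxdiag_k ((s *: drift_block (eta k).+1 (nu k)) ^+ m)) i j); last first.
  by apply/funext => m; rewrite /drift_mx scale_mxdiag mxdiag_exp.
rewrite (_ : (fun m => _) = fun m => m`!%:R^-1 *
    (if tagnat.sig1 i == tagnat.sig1 j
     then conform_mx 0 ((s *: drift_block (eta (tagnat.sig1 i)).+1 (nu (tagnat.sig1 i))) ^+ m)
     else 0) (tagnat.sig2 i) (tagnat.sig2 j)); last first.
  by apply/funext => m; rewrite mxdiagE.
(* The type of [tagnat.sig2 j] depends on the block of [j], so it is generalized before the two
   blocks are identified. *)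
rewrite mxdiagE; move: (tagnat.sig2 j).
case: eqVneq => [<-|neq12] l; last first.
  by rewrite mxE; apply: cvg_series_eq0 => m; rewrite mulr0.
rewrite conform_mx_id (_ : (fun m => _) = fun m => m`!%:R^-1 *
    ((s *: drift_block (eta (tagnat.sig1 i)).+1 (nu (tagnat.sig1 i))) ^+ m)
      (tagnat.sig2 i) l); first exact: cvg_series_drift_block.
by apply/funext => m; rewrite conform_mx_id.
Qed.

(** * Semigroup law, positivity and comparison for the block exponentials *)

Lemma shift_expD (R : realType) (n : nat) (nu s t : R) :
  shift_exp n nu s *m shift_exp n nu t = shift_exp n nu (s + t).
Proof.
apply/matrixP => i j; rewrite !mxE.
case: (leqP i j) => [le_ij|lt_ji]; last first.
  rewrite big1 // => l _; rewrite !mxE.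
  case: (leqP i l) => [le_il|_]; last by rewrite mul0r.
  by rewrite leqNgt (leq_trans lt_ji le_il) mulr0.
rewrite mulrDr expRD.
(* Only i <= l <= j contribute to the matrix product; the remaining sum, read in reverse order, is
   the binomial expansion of (s + t)^(j - i) over (j - i)!. *)
transitivity (\sum_(i <= l < j.+1) expR (- nu * s) * s ^+ (l - i) / (l - i)`!%:R *
    (expR (- nu * t) * t ^+ (j - l) / (j - l)`!%:R)); last first.
  rewrite -{1}[i : nat]add0n big_addn subSn // big_mkord.
  rewrite exprDn !mulr_sumr mulr_suml (reindex_inj rev_ord_inj) /=.
  apply: eq_bigr => l _; rewrite subSS.
  have le_l : (l <= j - i)%N by rewrite -ltnS.
  have -> : (j - i - l + i - i = j - i - l)%N by lia.
  have -> : (j - (j - i - l + i) = l)%N by lia.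
  rewrite -[(j - i)`!](bin_fact le_l) !natrM -mulr_natr.
  have C0 : 'C(j - i, l)%:R != 0 :> R by rewrite pnatr_eq0 -lt0n bin_gt0.
  have l0 : l`!%:R != 0 :> R by rewrite pnatr_eq0 -lt0n fact_gt0.
  have m0 : (j - i - l)`!%:R != 0 :> R by rewrite pnatr_eq0 -lt0n fact_gt0.
  by field; rewrite C0 l0 m0.
rewrite (@big_nat_widenl _ _ _ i 0) // big_mkord.
rewrite (big_ord_widen_cond n (fun l : nat => (i <= l)%N) (fun l : nat =>
    expR (- nu * s) * s ^+ (l - i) / (l - i)`!%:R *
    (expR (- nu * t) * t ^+ (j - l) / (j - l)`!%:R))) //.
rewrite [RHS]big_mkcond; apply: eq_bigr => l _; rewrite !mxE ltnS.
by case: (leqP i l); case: (leqP l j); rewrite /= ?mul0r ?mulr0.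
Qed.

Lemma shift_exp0 (R : realType) (n : nat) (nu : R) : shift_exp n nu 0 = 1%:M.
Proof.
apply/matrixP => i j; rewrite !mxE mulr0 expR0 mul1r.
case: (ltngtP i j) => [lt_ij|lt_ji|/val_inj ->].
- by rewrite expr0n subn_eq0 leqNgt lt_ij mul0r -val_eqE /= ltn_eqF.
- by rewrite -val_eqE /= gtn_eqF.
- by rewrite subnn expr0 divr1 eqxx.
Qed.

Lemma shift_exp_ge0 (R : realType) (n : nat) (nu s : R) (i j : 'I_n) :
  0 <= s -> 0 <= shift_exp n nu s i j.
Proof.
move=> s0; rewrite mxE; case: ifP => // _.
by rewrite !mulr_ge0 ?expR_ge0 ?exprn_ge0 ?invr_ge0.
Qed.

(** One step is monotone in both the state and the forcing, because [shift_exp] has nonnegative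
    entries; the order then propagates by induction. *)
Lemma forced_recursion_le (R : realType) (n : nat) (nu Delta : R) (imax : nat)
    (u v : nat -> 'cV[R]_n.+1) (a b : nat -> R) :
  0 <= Delta ->
  (forall i, (i < imax)%N -> u i.+1 =
    shift_exp n.+1 nu Delta *m (u i + (Delta * a i) *: delta_mx ord_max ord0)) ->
  (forall i, (i < imax)%N -> v i.+1 =
    shift_exp n.+1 nu Delta *m (v i + (Delta * b i) *: delta_mx ord_max ord0)) ->
  u 0%N = v 0%N -> (forall i, (i < imax)%N -> a i <= b i) ->
  forall i, (i <= imax)%N -> forall j, u i j ord0 <= v i j ord0.
Proof.
move=> Delta0 uS vS uv0 le_ab; elim => [|i IHi] lt_i j; first by rewrite uv0.
rewrite uS // vS // !mxE; apply: ler_sum => l _.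
rewrite ler_wpM2l ?shift_exp_ge0 // !mxE lerD ?IHi 1?ltnW //.
by rewrite ler_wpM2r ?ler0n // ler_wpM2l ?le_ab.
Qed.

(** * The standard normal law: integrability and zero mean *)

Lemma lebesgue_measure_oppr (R : realType) (A : set R) : measurable A ->
  lebesgue_measure (-%R @^-1` A) = lebesgue_measure A.
Proof.
move=> mA.
pose oppT : measurableTypeR R -> measurableTypeR R := -%R.
have mopp : measurable_fun [set: measurableTypeR R] oppT by rewrite /oppT.
(* Lebesgue measure is determined by half-open intervals; reflection only moves the closed end to
   the other side. *)
rewrite [RHS](@lebesgue_measure_unique R (pushforward lebesgue_measure oppT)) //.
move=> _ [[a b] _ <-]; rewrite /= /pushforward /=.
rewrite lebesgue_measure_itv /= (_ : _ @^-1` _ = `[(- b), (- a)[%classic).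
  by rewrite lebesgue_measure_itv /= !lte_fin ltrN2; case: ifP => // _; rewrite -!EFinB opprK addrC.
by apply/seteqP; split => x /=; rewrite !in_itv /= /oppT ltrNr lerNl andbC.
Qed.

Section standard_normal.
Variable R : realType.
Local Notation mu := (@lebesgue_measure R).
Local Notation N := (@normal_prob R 0 1).
Local Open Scope ereal_scope.

(** Change of variables with the Radon-Nikodym derivative, which equals the Gaussian density almost
    everywhere since both have the same integral over every measurable set. *)
Lemma ge0_integral_normal_prob (f : R -> \bar R) :
  measurable_fun [set: R] f -> (forall x, 0 <= f x) ->
  \int[N]_x f x = \int[mu]_x (f x * (normal_pdf 0 1 x)%:E).
Proof.
move=> mf f0; have Nmu := @normal_prob_dominates R 0 1.
rewrite -(Radon_Nikodym_SigmaFinite.change_of_variables Nmu) //.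
have mpdf : measurable_fun [set: R] (fun x => (normal_pdf 0 1 x)%:E : \bar R).
  by apply/measurable_EFinP; exact: measurable_normal_pdf.
have RNint := Radon_Nikodym_SigmaFinite.f_integrable Nmu.
apply: ae_eq_integral => //; [| |apply: ae_eqe_mul2l].
- exact: emeasurable_funM mf (measurable_int _ RNint).
- exact: emeasurable_funM mf mpdf.
- apply: integral_ae_eq => //.
  by move=> E _ mE; rewrite -Radon_Nikodym_SigmaFinite.f_integral.
Qed.

Lemma normal_pdf_oppr (x : R) : normal_pdf 0 1 (- x)%R = normal_pdf 0 1 x.
Proof. by rewrite !normal_pdfE // /normal_fun !subr0 sqrrN. Qed.

(** This supplies an integrable majorant. Apart from the peaks, the density of deviation 2 exceeds
    that of deviation 1 by the factor e^(3x^2/8), and |x| <= 2 (1 + 3x^2/8) <= 2 e^(3x^2/8). *)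
Lemma normr_normal_pdf_le (x : R) :
  (`|x| * normal_pdf 0 1 x <=
     2 * normal_peak 1 / normal_peak 2 * normal_pdf 0 2 x)%R.
Proof.
have pk2 : (0 < normal_peak (2 : R))%R by exact: normal_peak_gt0.
rewrite !normal_pdfE // [leRHS]mulrA divfK ?gt_eqF // mulrCA -mulrA [leRHS]mulrCA.
rewrite ler_wpM2l ?normal_peak_ge0 // /normal_fun !subr0.
have -> : (- x ^+ 2 / (2 ^+ 2 *+ 2) = 3 / 8 * x ^+ 2 + - x ^+ 2 / (1 ^+ 2 *+ 2) :> R)%R.
  by field.
rewrite expRD mulrA ler_wpM2r ?expR_ge0 //.
apply: (@le_trans _ _ (2 * (1 + 3 / 8 * x ^+ 2)))%R.
  by rewrite -[(x ^+ 2)%R]real_normK ?num_real //; have := normr_ge0 x; nra.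
by rewrite ler_pM2l // expR_ge1Dx.
Qed.

Lemma integrable_id_normal_prob : N.-integrable [set: R] EFin.
Proof.
apply/integrableP; split; first exact/measurable_EFinP.
rewrite ge0_integral_normal_prob //; last first.
  by apply: measurableT_comp => //; exact/measurable_EFinP.
pose C := (2 * normal_peak 1 / normal_peak 2 : R)%R.
apply: (@le_lt_trans _ _ (\int[mu]_x (C * normal_pdf 0 2 x)%:E)).
  apply: ge0_le_integral => //.
  - by move=> x _; rewrite mule_ge0 // lee_fin normal_pdf_ge0.
  - apply: emeasurable_funM; first by apply: measurableT_comp => //; exact/measurable_EFinP.
    by apply/measurable_EFinP; exact: measurable_normal_pdf.
  - apply/measurable_EFinP; apply: measurable_funM => //; exact: measurable_normal_pdf.
  - by move=> x _; rewrite /= -EFinM lee_fin normr_normal_pdf_le.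
under eq_integral do rewrite EFinM.
rewrite integralZl //; last exact: integrable_normal_pdf.
by rewrite integral_normal_pdf mule1 ltry.
Qed.

(** Reflection preserves Lebesgue measure and the density, and exchanges the positive and negative
    parts of the identity. Their integrals are equal, and finite by integrability, so the difference
    is 0. *)
Lemma integral_id_normal_prob : \int[N]_x x%:E = 0.
Proof.
rewrite integralE.
have m1 : measurable_fun [set: R] (EFin : R -> \bar R) by exact/measurable_EFinP.
have mp := measurable_funepos m1; have mn := measurable_funeneg m1.
have <- : \int[N]_x (EFin^\+ x) = \int[N]_x (EFin^\- x).
  rewrite !ge0_integral_normal_prob //.
  pose oppT : measurableTypeR R -> measurableTypeR R := -%R.
  have mopp : measurable_fun [set: measurableTypeR R] oppT by rewrite /oppT.
  rewrite (eq_measure_integral (pushforward mu oppT)); last first.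
    by move=> A mA _; exact/esym/lebesgue_measure_oppr.
  rewrite ge0_integral_pushforward.
  - rewrite preimage_setT; apply: eq_integral => x _ /=.
    by rewrite normal_pdf_oppr funeposE funenegE /oppT EFinN.
  - exact: mopp.
  - exact: measurableT.
  - apply: emeasurable_funM; first exact: mp.
    by apply/measurable_EFinP; exact: measurable_normal_pdf.
  - by move=> x _; rewrite mule_ge0 // lee_fin normal_pdf_ge0.
rewrite subee //; apply: integrable_fin_num => //.
exact: integrable_funepos integrable_id_normal_prob.
Qed.

End standard_normal.

(** * Products with an independent centred factor *)

Section independent_product.
Context d (T : measurableType d) (R : realType) (P : probability T R).
Local Open Scope ereal_scope.

(** Independence on rectangles identifies the joint law of [(g, Z)] with the product of the
    marginals. Boundedness of [g] gives the integrability that Fubini requires, and the inner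
    integral over the law of [Z] is zero. *)
Lemma integral_independent_mul (g Z : T -> R) :
  measurable_fun [set: T] g -> [bounded g x | x in [set: T]] ->
  P.-integrable [set: T] (EFin \o Z) ->
  (forall A B, measurable A -> measurable B ->
    P (g @^-1` A `&` Z @^-1` B) = P (g @^-1` A) * P (Z @^-1` B)) ->
  \int[P]_w (Z w)%:E = 0 -> \int[P]_w (g w * Z w)%:E = 0.
Proof.
move=> mg bg intZ gZ Z0.
have mZ : measurable_fun [set: T] Z by apply/measurable_EFinP; exact: measurable_int intZ.
pose G : {RV P >-> R} := HB.pack g (isMeasurableFun.Build _ _ _ _ g mg).
pose Y : {RV P >-> R} := HB.pack Z (isMeasurableFun.Build _ _ _ _ Z mZ).
pose w x := (g x, Z x).
have mw : measurable_fun [set: T] w by exact/measurable_fun_pair.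
pose W : {RV P >-> (R * R)%type} := HB.pack w (isMeasurableFun.Build _ _ _ _ w mw).
pose f (z : R * R) : \bar R := (z.1 * z.2)%:E.
have mf : measurable_fun [set: R * R] f.
  by apply/measurable_EFinP; apply: measurable_funM.
have intfW : P.-integrable [set: T] (f \o W).
  exact: (integrableMr measurableT mg bg intZ).
have lawW A : measurable A ->
    (distribution P G \x distribution P Y) A = distribution P W A.
  by apply: product_measure_unique => B C mB mC; exact: gZ.
have intf : (distribution P G \x distribution P Y).-integrable setT f.
  apply/integrableP; split => //.
  rewrite (eq_measure_integral (distribution P W)); last first.
    by move=> A mA _; exact: lawW.
  rewrite ge0_integral_distribution //; last exact: measurableT_comp.
  by case/integrableP : intfW.
rewrite -[LHS](integral_distribution mf intfW).
rewrite (eq_measure_integral (distribution P G \x distribution P Y)%E); last first.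
  by move=> A mA _; exact/esym/lawW.
rewrite -integral12_prod_meas1 //= integral0_eq // => x _.
rewrite /fubini_F; under eq_integral do rewrite /f /= EFinM.
have intY : (distribution P Y).-integrable [set: R] EFin.
  by apply: integrable_pushforward => //; exact/measurable_EFinP.
rewrite integralZl // integral_distribution //.
by rewrite Z0 mule0.
Qed.

End independent_product.

(** * The past of the scheme and its independence from the current noise *)

Section past_sigma_algebra.
Context d d' (T : measurableType d) (T' : measurableType d') (R : realType)
  (P : probability T R) (n : nat) (xi : 'I_n -> {RV P >-> T'}).

(* The cylinder sets over [xi 0], ..., [xi (i - 1)]; the sigma-algebra they
   generate is the past of the scheme before step [i]. *)
Definition past (i : nat) : set (set T) :=
  [set \bigcap_(j in [set j : 'I_n | (j < i)%N]) xi j @^-1` U j |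
    U in [set U : 'I_n -> set T' | forall j, measurable (U j)]].

Lemma past_measurable i : past i `<=` measurable.
Proof.
move=> _ [U mU <-]; apply: fin_bigcap_measurable => // j _.
exact: measurable_funPTI.
Qed.

Lemma past_setT i : past i setT.
Proof. by exists (fun=> setT) => //; apply: bigcapT. Qed.

Lemma past_setI i : setI_closed (past i).
Proof.
move=> _ _ [U mU <-] [V mV <-]; exists (fun j => U j `&` V j).
  by move=> j; exact: measurableI.
by rewrite -bigcapI.
Qed.

Lemma past_le i k : (i <= k)%N -> past i `<=` past k.
Proof.
move=> le_ik _ [U mU <-]; exists (fun j : 'I_n => if (j < i)%N then U j else setT).
  by move=> j; case: ifP.
apply/seteqP; split => w Uw j lt_j.
  by have := Uw j (leq_trans lt_j le_ik); rewrite lt_j.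
by case: ifP => // lt_ji; exact: Uw.
Qed.

Lemma past_preimage (j : 'I_n) i (B : set T') :
  (j < i)%N -> measurable B -> past i (xi j @^-1` B).
Proof.
move=> lt_ji mB; exists (fun k => if k == j then B else setT).
  by move=> k; case: ifP.
apply/seteqP; split => w; first by move/(_ j lt_ji); rewrite eqxx.
by move=> Bw k _; case: eqP => // ->.
Qed.

(** For fixed [B], both sides are finite measures in [E]. They agree on [past i], which is stable
    under intersection, hence on the sigma-algebra it generates. *)
Lemma past_independent (i : 'I_n) (E : set T) (B : set T') :
  independent_RVs xi -> <<s past i >> E -> measurable B ->
  (P (E `&` xi i @^-1` B) = P E * P (xi i @^-1` B))%E.
Proof.
move=> indep sE mB.
have mXB : measurable (xi i @^-1` B) by exact: measurable_funPTI.
have PXB : P (xi i @^-1` B) \is a fin_num by exact: fin_num_measure.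
(* [mscale] expects a nonnegative real, so the probability of the noise event is packaged as one. *)
pose r : {nonneg R} := NngNum (fine_ge0 (measure_ge0 P (xi i @^-1` B))).
have rE : (r%:num)%:E = P (xi i @^-1` B) by rewrite /r /= fineK.
rewrite muleC -rE.
apply: (@g_sigma_algebra_measure_unique _ _ _ (past i) (@past_measurable i)
  (fun=> setT) (fun=> past_setT i) _ (mrestr P mXB) (mscale r P)) => //.
- by apply/seteqP; split => // w _; exists 0%N.
- exact: past_setI.
- move=> _ [U mU <-]; rewrite /= /mrestr /mscale rE [RHS]muleC.
  pose J := [set j : 'I_n | (j < i)%N]%SET.
  (* [V] extends the cylinder by the event [B] at index [i], so that independence applies once over
     [i |: J] and once, backwards, over [J]. *)
  pose V j := if j == i then B else U j.
  have mV j : measurable (V j) by rewrite /V; case: ifP.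
  have iJ : i \notin J by rewrite finset.in_set ltnn.
  transitivity (P (\bigcap_(j in [set` (i |: J)%SET]) xi j @^-1` V j)).
    congr (P _); apply/seteqP; split => w.
      move=> [Uw Bw] j /=; rewrite finset.in_setU1 finset.in_set /V.
      case: eqP => [-> //|_ /= lt_ji].
      exact: Uw.
    move=> Vw; split.
      move=> j lt_ji; have := Vw j; rewrite /= finset.in_setU1 finset.in_set lt_ji orbT => /(_ isT).
      by rewrite /V; case: eqP lt_ji => // ->; rewrite /= ltnn.
    by have := Vw i; rewrite /= finset.in_setU1 eqxx => /(_ isT); rewrite /V eqxx.
  rewrite indep // big_setU1 //= /V eqxx muleC; congr (_ * _)%E.
  transitivity (\prod_(j in J) P (xi j @^-1` U j))%E.
    by apply: eq_bigr => j; rewrite finset.in_set; case: eqP => // ->; rewrite ltnn.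
  rewrite -indep //; congr (P _); apply/seteqP; split => w Uw j /=.
    by move=> lt_ji; apply: Uw; rewrite /= finset.in_set.
  by rewrite finset.in_set; exact: Uw.
- move=> _; rewrite /mrestr (le_lt_trans (probability_le1 _ _)) ?ltry //.
  by rewrite setTI.
Qed.

End past_sigma_algebra.

(** * Integrals of linear combinations *)

Lemma Rintegral_lincomb d (T : measurableType d) (R : realType)
    (P : probability T R) (n : nat) (a : 'I_n -> R) (h : 'I_n -> T -> R) :
  (forall l, P.-integrable [set: T] (EFin \o h l)) ->
  P.-integrable [set: T] (EFin \o (fun w => \sum_(l < n) a l * h l w)) /\
  \int[P]_w (\sum_(l < n) a l * h l w) = \sum_(l < n) a l * \int[P]_w (h l w).
Proof.
move=> inth.
have intah l : P.-integrable [set: T] (fun w => (a l * h l w)%:E).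
  by have := integrableZl measurableT (a l) (inth l); apply: eq_integrable.
have -> : EFin \o (fun w => \sum_(l < n) a l * h l w) =
    (fun w => \sum_(l < n) (a l * h l w)%:E)%E.
  by apply/funext => w; rewrite /= sumEFin.
split; first exact: integrable_sum.
rewrite /Rintegral; under eq_integral do rewrite -sumEFin.
rewrite integral_sum // -sum_fine => [|l _]; last exact: integrable_fin_num.
by apply: eq_bigr => l _; rewrite -RintegralZl.
Qed.

Lemma Rintegral_addZ d (T : measurableType d) (R : realType)
    (P : probability T R) (a : R) (g h : T -> R) :
  P.-integrable [set: T] (EFin \o g) -> P.-integrable [set: T] (EFin \o h) ->
  P.-integrable [set: T] (EFin \o (fun w => g w + a * h w)) /\
  \int[P]_w (g w + a * h w) = \int[P]_w g w + a * \int[P]_w h w.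
Proof.
move=> intg inth.
have intah : P.-integrable [set: T] (EFin \o (fun w => a * h w)).
  by have := integrableZl measurableT a inth; apply: eq_integrable.
split; last by rewrite RintegralD // RintegralZl.
by have := integrableD measurableT intg intah; apply: eq_integrable.
Qed.

Lemma measurable_col2 (R : realType) (m : 'I_2) :
  measurable_fun [set: R * R] (fun z => col2 z m ord0 : R).
Proof.
rewrite (_ : (fun z => _) = fun z : R * R => if m == ord0 then z.1 else z.2).
  by case: (m == ord0); [exact: measurable_fst|exact: measurable_snd].
by apply/funext => z; rewrite mxE.
Qed.

(** * The splitting step in block coordinates *)

Section block_coordinates.
Variables (R : realType) (eta : 'I_2 -> nat).
Implicit Types (x y : 'cV[R]_(kappa eta)) (k : 'I_2).

Lemma submxcolZ n (p : 'I_n -> nat) m (a : R) (x : 'M[R]_(\sum_i p i, m)) (k : 'I_n) :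
  submxcol (a *: x) k = a *: submxcol x k.
Proof. by apply/matrixP => i j; rewrite !mxE. Qed.

Lemma submxcol_expmx_drift (nu : 'I_2 -> R) s x k :
  submxcol (expmx (s *: drift_mx eta nu) *m x) k =
    shift_exp (eta k).+1 (nu k) s *m submxcol x k.
Proof. by rewrite expmx_drift -{1}(submxcolK x) mul_mxdiag_mxcol mxcolK. Qed.

Variables (nu c p : 'I_2 -> R) (N : nat) (f : 'I_2 -> R -> R) (Delta : R).

Definition noise_coef k : R :=
  Num.sqrt Delta / Num.sqrt N%:R * (c k / Num.sqrt (p (ordS k))).

(** The exponential acts on each block separately, so the other population enters only through the
    drift and diffusion in the last coordinate of the block. *)
Lemma block_coord_step x (z : 'cV[R]_2) k (j : 'I_(eta k).+1) :
  let y := block_coord x (k := ordS k) ord0 in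
  block_coord (lie_trotter_step nu c p N f Delta x z) j =
  \sum_l shift_exp (eta k).+1 (nu k) Delta j l *
    (block_coord x l + if l == ord_max then
       Delta * (c k * f (ordS k) y) +
       noise_coef k * (Num.sqrt (f (ordS k) y) * z (ordS k) ord0)
     else 0).
Proof.
move=> y; rewrite /block_coord /lie_trotter_step submxcol_expmx_drift mxE.
apply: eq_bigr => l _; congr (_ * _).
rewrite !submxcolD !submxcolZ /drift_fun /diffusion mxcol_mul !mxcolK !mxE -addrA.
congr (_ + _); case: eqVneq => [->|neq_l]; last first.
  by rewrite mulr0 add0r big1 ?mulr0 // => m _; rewrite mxE (negPf neq_l) mul0r.
congr (_ + _); rewrite /noise_coef -!mulrA; congr (_ * (_ * _)).
(* The last row of the diffusion block has its only nonzero entry in column [ordS k]. *)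
rewrite (bigD1 (ordS k)) //= mxE !eqxx big1 ?addr0 => [|m]; first by rewrite -!mulrA.
by move=> /negPf neq_m; rewrite mxE neq_m andbF mul0r.
Qed.

End block_coordinates.

(* [constantly_forced a] is the mean of the scheme when the drift entering the
   last coordinate is the constant [a]; [mean_boundE] matches it with
   [mean_bound], whose sum has the additional term [l = 0]. *)
Section constant_forcing.
Variables (R : realType) (eta : 'I_2 -> nat) (nu : 'I_2 -> R) (k : 'I_2)
  (Delta : R) (x0 : 'cV[R]_(kappa eta)).

Local Notation S := (shift_exp (eta k).+1 (nu k)).
Local Notation last_vec := (delta_mx (@ord_max (eta k)) ord0 : 'cV[R]_(eta k).+1).

Definition constantly_forced (a : R) (i : nat) : 'cV[R]_(eta k).+1 :=
  S (i%:R * Delta) *m submxcol x0 k +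
  (Delta * a) *: \sum_(0 <= l < i) (S (l.+1%:R * Delta) *m last_vec).

Lemma constantly_forced0 a : constantly_forced a 0 = submxcol x0 k.
Proof.
by rewrite /constantly_forced mul0r shift_exp0 mul1mx big_nil scaler0 addr0.
Qed.

(** By the semigroup law, [S Delta] advances every summand by one time step, and the newly added
    forcing becomes the first summand. *)
Lemma constantly_forcedS a i :
  constantly_forced a i.+1 =
  S Delta *m (constantly_forced a i + (Delta * a) *: last_vec).
Proof.
rewrite /constantly_forced !mulmxDr -!scalemxAr mulmxA shift_expD -addrA -scalerDr.
rewrite mulmx_sumr -natr1 mulrDl mul1r [Delta + _]addrC; congr (_ + _ *: _).
rewrite big_nat_recl // mul1r addrC; congr (_ + _); apply: eq_bigr => l _.
by rewrite mulmxA shift_expD -[in LHS]natr1 mulrDl mul1r [Delta + _]addrC.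
Qed.

Lemma mean_boundE (opt : R -> R -> R) (c fmax : 'I_2 -> R) (i : nat)
    (j : 'I_(eta k).+1) :
  (forall y m, 0 < m -> opt 0 (y / m) = opt 0 y / m) ->
  mean_bound opt nu c fmax Delta x0 i j =
  constantly_forced (opt 0 (c k * fmax (ordS k))) i j ord0 +
  Delta * (expR (- nu k * (0%:R * Delta)) * (0%:R * Delta) ^+ (eta k - j) *
    opt 0 (c k * fmax (ordS k) / (eta k - j)`!%:R)).
Proof.
move=> opt_div; rewrite /mean_bound /constantly_forced big_nat_recl // mulrDr.
rewrite [X in _ + X]addrC addrA; congr (_ + _).
rewrite /block_coord submxcol_expmx_drift [RHS]mxE; congr (_ + _).
rewrite mxE -[RHS]mulrA; congr (_ * _); rewrite summxE mulr_sumr; apply: eq_bigr => l _.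
(* Multiplying by [last_vec] selects the last column of [S]; its factorial is then absorbed into
   [opt] by [opt_div]. *)
rewrite mxE (bigD1 ord_max) //= big1 ?addr0 => [|m neq_m]; last first.
  by rewrite [X in _ * X]mxE (negPf neq_m) mulr0.
rewrite !mxE !eqxx -ltnS ltn_ord mulr1 opt_div ?ltr0n ?fact_gt0 //; ring.
Qed.

End constant_forcing.

(** * Adaptedness, integrability and mean recursion of the scheme *)

Section moments.
Context (R : realType) d (T : measurableType d) (P : probability T R).
Variables (eta : 'I_2 -> nat) (nu c p fmax : 'I_2 -> R) (N : nat)
  (f : 'I_2 -> R -> R) (Delta : R) (x0 : 'cV[R]_(kappa eta)) (imax : nat)
  (xi : 'I_imax -> {RV P >-> (R * R)%type})
  (X : nat -> T -> 'cV[R]_(kappa eta)).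
Hypotheses (hf : assumptionA f fmax)
  (hxi_normal : forall i, standard_normal2 (xi i))
  (hxi_indep : independent_RVs xi)
  (hX : lie_trotter_scheme nu c p N f Delta x0 xi X).

Local Notation past_fun i g :=
  (measurable_fun [set: g_sigma_algebraType (past xi i)] (g : T -> R)).

Lemma past_fun_measurable i (g : T -> R) : past_fun i g -> measurable_fun [set: T] g.
Proof.
move=> mg _ B mB; have : <<s past xi i >> ([set: T] `&` g @^-1` B) by exact: mg.
by apply: smallest_sub; [exact: sigma_algebra_measurable|exact: past_measurable].
Qed.

Lemma past_fun_le i k (g : T -> R) : (i <= k)%N -> past_fun i g -> past_fun k g.
Proof.
move=> le_ik mg mT B mB.
have : <<s past xi i >> ([set: T] `&` g @^-1` B) by exact: mg.
by apply: sub_smallest2r; [exact: smallest_sigma_algebra|exact: past_le].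
Qed.

Lemma past_xi (j : 'I_imax) i : (j < i)%N ->
  measurable_fun [set: g_sigma_algebraType (past xi i)] (xi j : T -> R * R).
Proof.
move=> lt_ji _ B mB; rewrite setTI.
by apply: sub_sigma_algebra; exact: past_preimage.
Qed.

Lemma f_nondecreasing k : nondecreasing_fun (f k).
Proof. by have [_ + _] := hf k. Qed.

Lemma f_bounds k y : 0 <= f k y <= fmax k.
Proof. by have [_ _ /(_ y)/andP[/ltW -> ->]] := hf k. Qed.

(** Monotone functions are Borel; this makes the noise amplitude measurable. *)
Lemma sqrt_f_nondecreasing k : nondecreasing_fun (Num.sqrt \o f k).
Proof. by move=> y z le_yz; apply: ler_wsqrtr; exact: f_nondecreasing. Qed.

(** A component event pulls back to a cylinder whose other factor has mass 1, so each component is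
    standard normal and inherits integrability and zero mean from that law. *)
Lemma xi_component_integral (i : 'I_imax) (m : 'I_2) :
  P.-integrable [set: T] (fun w => (col2 (xi i w) m ord0)%:E) /\
  (\int[P]_w (col2 (xi i w) m ord0)%:E = 0)%E.
Proof.
pose g (z : R * R) : R := col2 z m ord0.
have mg : measurable_fun [set: R * R] g by exact: measurable_col2.
have -> : (fun w => (col2 (xi i w) m ord0)%:E) = EFin \o (g \o xi i) by [].
have mgX : measurable_fun [set: T] (g \o xi i) by exact: measurableT_comp.
pose Y : {RV P >-> R} := HB.pack (g \o xi i) (isMeasurableFun.Build _ _ _ _ _ mgX).
have lawY A : measurable A -> distribution P Y A = normal_prob 0 1 A.
  move=> mA; transitivity (distribution P (xi i) (g @^-1` A)) => //.
  rewrite hxi_normal; last by rewrite -[X in measurable X]setTI; exact: mg.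
  rewrite (_ : g = fun z => if m == ord0 then z.1 else z.2); last first.
    by apply/funext => z; rewrite /g mxE.
  case: eqP => _.
    rewrite (_ : _ @^-1` _ = A `*` setT); last by apply/seteqP; split => z //= [].
    by rewrite product_measure1E // [X in (_ * X)%E]probability_setT mule1.
  rewrite (_ : _ @^-1` _ = setT `*` A); last by apply/seteqP; split => z //= [].
  by rewrite product_measure1E // [X in (X * _)%E]probability_setT mul1e.
(* [normal_prob] lives on [measurableTypeR R], whose display differs from that
   of [R]; the two measurable structures are related by the identity map. *)
pose idR : measurableTypeR R -> R := id.
have midR : measurable_fun [set: measurableTypeR R] idR by move=> _ B mB; rewrite setTI.
have mEFin : measurable_fun [set: R] (EFin : R -> \bar R) by exact/measurable_EFinP.
have intY : P.-integrable [set: T] (EFin \o Y).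
  apply/integrableP; split; first exact/measurable_EFinP.
  have /integrableP[_] := integrable_id_normal_prob R.
  suff -> : (\int[P]_w `|(EFin \o Y) w| = \int[normal_prob 0 1]_y `|y%:E|)%E by [].
  rewrite -(@ge0_integral_distribution _ _ _ _ _ P Y (fun y => `|y%:E|)%E) //; last first.
    exact: measurableT_comp.
  rewrite (eq_measure_integral (pushforward (normal_prob 0 1) idR)); last first.
    by move=> A mA _; exact: lawY.
  by rewrite ge0_integral_pushforward //; exact: measurableT_comp.
split=> //; rewrite -[LHS](@integral_distribution _ _ _ _ _ P Y EFin) //.
rewrite (eq_measure_integral (pushforward (normal_prob 0 1) idR)); last first.
  by move=> A mA _; exact: lawY.
rewrite integral_pushforward //; first exact: integral_id_normal_prob.
exact: integrable_id_normal_prob.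
Qed.

Let x i k (j : 'I_(eta k).+1) w := block_coord (X i w) j.
Let fx i k w := f (ordS k) (x i (k := ordS k) ord0 w).

Let forced (i : 'I_imax) k (l : 'I_(eta k).+1) w :=
  x i l w + if l == ord_max then Delta * (c k * fx i k w) +
    noise_coef c p N Delta k * (Num.sqrt (fx i k w) * col2 (xi i w) (ordS k) ord0)
  else 0.

Lemma coordS (i : 'I_imax) k (j : 'I_(eta k).+1) :
  x i.+1 j = fun w => \sum_l shift_exp (eta k).+1 (nu k) Delta j l * forced i l w.
Proof. by apply/funext => w; rewrite /x hX.2 block_coord_step. Qed.

(** Adaptedness by induction: step [i.+1] combines coordinates of step [i], measurable for the
    smaller past, with the noise [xi i], which [past i.+1] includes. *)
Lemma past_coord i k (j : 'I_(eta k).+1) : (i <= imax)%N -> past_fun i (x i j).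
Proof.
elim: i k j => [|i IHi] k j lt_i.
  rewrite (_ : x 0%N j = cst (block_coord x0 j)); first exact: measurable_cst.
  by apply/funext => w; rewrite /x hX.1.
have {}IHi k' (j' : 'I_(eta k').+1) : past_fun i.+1 (x i j').
  by apply: (past_fun_le (leqnSn i)); apply: IHi; exact: ltnW.
rewrite (@coordS (Ordinal lt_i)) /forced.
apply: measurable_sum => l; apply: measurable_funM => //.
apply: measurable_funD; first exact: IHi.
case: eqP => _; last exact: measurable_cst.
have mfx g : nondecreasing_fun g -> past_fun i.+1 (fun w => g (x i (k := ordS k) ord0 w)).
  move=> ndg; apply: (@measurableT_comp _ _ _ _ _ _ g) => //.
  exact: nondecreasing_measurable.
apply: measurable_funD; apply: measurable_funM => //.
  by apply: measurable_funM => //; exact: mfx (@f_nondecreasing _).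
apply: measurable_funM; first exact: mfx (@sqrt_f_nondecreasing _).
have mxi := @past_xi (Ordinal lt_i) i.+1 (ltnSn i).
apply: (@measurableT_comp _ _ _ _ _ _ (fun z : R * R => col2 z (ordS k) ord0)) mxi.
exact: measurable_col2.
Qed.

Lemma fx_measurable i k : (i <= imax)%N -> past_fun i (fx i k).
Proof.
move=> le_i; apply: (@measurableT_comp _ _ _ _ _ _ (f (ordS k))); last exact: past_coord.
by apply: nondecreasing_measurable => //; exact: f_nondecreasing.
Qed.

Lemma fx_integrable i k : (i <= imax)%N -> P.-integrable [set: T] (EFin \o fx i k).
Proof.
move=> le_i; apply: measurable_bounded_integrable => //.
- exact: (le_lt_trans (probability_le1 P measurableT) (ltry 1)).
- by apply: (@past_fun_measurable i); exact: fx_measurable.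
- exists (fmax (ordS k)); split; first exact: num_real.
  move=> y lt_y w _; have /andP[f0 fle] := f_bounds (ordS k) (x i (k := ordS k) ord0 w).
  by rewrite /= ger0_norm // (le_trans fle) // ltW.
Qed.

(** The amplitude is bounded and depends on the past alone, while the noise at step [i] is centred
    and independent of that past. *)
Lemma noise_integral (i : 'I_imax) k :
  let g w := Num.sqrt (fx i k w) * col2 (xi i w) (ordS k) ord0 in
  P.-integrable [set: T] (EFin \o g) /\ \int[P]_w g w = 0.
Proof.
have le_i : (i <= imax)%N by exact: ltnW.
pose s w := Num.sqrt (fx i k w).
have ms : past_fun i s.
  apply: (@measurableT_comp _ _ _ _ _ _ (Num.sqrt \o f (ordS k))); last exact: past_coord.
  by apply: nondecreasing_measurable => //; exact: sqrt_f_nondecreasing.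
have bs : [bounded s w | w in [set: T]].
  exists (Num.sqrt (fmax (ordS k))); split; first exact: num_real.
  move=> y lt_y w _; have /andP[f0 fle] := f_bounds (ordS k) (x i (k := ordS k) ord0 w).
  by rewrite /= ger0_norm ?sqrtr_ge0 // (le_trans _ (ltW lt_y)) // ler_wsqrtr.
have [intZ Z0] := xi_component_integral i (ordS k).
split; first exact: (integrableMr measurableT (past_fun_measurable ms) bs intZ).
rewrite /Rintegral (@integral_independent_mul _ _ _ P s) //.
- exact: past_fun_measurable ms.
- move=> A B mA mB.
  apply: (past_independent (B := (fun z => col2 z (ordS k) ord0) @^-1` B)) => //.
    by rewrite -[X in <<s _ >> X]setTI; exact: ms.
  by rewrite -[X in measurable X]setTI; exact: measurable_col2.
Qed.

Let mean i k (j : 'I_(eta k).+1) : R := \int[P]_w x i j w.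

(** The noise term drops out of the mean. Integrability of the coordinate is a premise because
    [coord_integrable] derives it by induction through this lemma. *)
Lemma forced_integral (i : 'I_imax) k (l : 'I_(eta k).+1) :
  P.-integrable [set: T] (EFin \o x i l) ->
  P.-integrable [set: T] (EFin \o forced i l) /\
  \int[P]_w forced i l w =
    mean i l + if l == ord_max then Delta * (c k * \int[P]_w fx i k w) else 0.
Proof.
move=> intx; rewrite /forced; case: eqP => [_|_]; last first.
  by under [X in EFin \o X]eq_fun do rewrite addr0;
    under eq_Rintegral do rewrite addr0; rewrite addr0.
have [intn n0] := noise_integral i k.
have intf := fx_integrable k (ltnW (ltn_ord i)).
have [int1 E1] := Rintegral_addZ (Delta * c k) intx intf.
have [int2 E2] := Rintegral_addZ (noise_coef c p N Delta k) int1 intn.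
rewrite (_ : (fun w => _) = fun w => x i l w + Delta * c k * fx i k w +
    noise_coef c p N Delta k * (Num.sqrt (fx i k w) * col2 (xi i w) (ordS k) ord0)).
  by rewrite E2 E1 n0 mulr0 addr0 mulrA.
by apply/funext => w; rewrite addrA mulrA.
Qed.

Lemma coord_integrable i k (j : 'I_(eta k).+1) : (i <= imax)%N ->
  P.-integrable [set: T] (EFin \o x i j).
Proof.
elim: i k j => [|i IHi] k j lt_i.
  rewrite (_ : x 0%N j = cst (block_coord x0 j)); last by apply/funext => w; rewrite /x hX.1.
  exact: finite_measure_integrable_cst.
rewrite (@coordS (Ordinal lt_i)); apply: (Rintegral_lincomb _ _).1 => l.
by apply: (forced_integral _).1; apply: IHi; exact: ltnW.
Qed.

Lemma meanS (i : 'I_imax) k (j : 'I_(eta k).+1) :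
  mean i.+1 j = \sum_l shift_exp (eta k).+1 (nu k) Delta j l *
    (mean i l + if l == ord_max then Delta * (c k * \int[P]_w fx i k w) else 0).
Proof.
have le_i : (i <= imax)%N by exact: ltnW.
have int_forced (l : 'I_(eta k).+1) := forced_integral (coord_integrable l le_i).
rewrite /mean coordS (Rintegral_lincomb _ _).2 => [|l]; last exact: (int_forced l).1.
by apply: eq_bigr => l _; rewrite (int_forced l).2.
Qed.

Lemma fx_integral_bounds i k : (i <= imax)%N ->
  0 <= \int[P]_w fx i k w <= fmax (ordS k).
Proof.
move=> le_i; have fb w := f_bounds (ordS k) (x i (k := ordS k) ord0 w).
apply/andP; split.
  by apply: Rintegral_ge0 => // w _; case/andP: (fb w).
have -> : fmax (ordS k) = \int[P]_w (cst (fmax (ordS k)) w).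
  by rewrite Rintegral_cst // [X in fine X]probability_setT mulr1.
apply: le_Rintegral => //; first exact: fx_integrable.
  exact: finite_measure_integrable_cst.
by move=> w _; case/andP: (fb w).
Qed.

(** Integrability makes the extended-real expectation finite, so the [fine] in the real integral
    loses nothing. *)
Lemma block_coord_mean i k (j : 'I_(eta k).+1) : (i <= imax)%N ->
  ('E_P[fun w => block_coord (X i w) j] = (mean i j)%:E)%E.
Proof.
move=> le_i; rewrite unlock /mean /Rintegral fineK //.
by apply: integrable_fin_num => //; exact: coord_integrable.
Qed.

Lemma mean_bounds i k (j : 'I_(eta k).+1) : 0 <= Delta -> (i <= imax)%N ->
  mean_bound Num.min nu c fmax Delta x0 i j <= mean i j <=
  mean_bound Num.max nu c fmax Delta x0 i j.
Proof.
move=> Delta0 le_i.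
(* [b] is the true mean forcing; it makes the column of means [u] a forced recursion, comparable
   with the constantly forced [v]. *)
pose b i := c k * \int[P]_w fx i k w.
pose u i : 'cV[R]_(eta k).+1 := \col_l mean i l.
pose v a i := constantly_forced nu k Delta x0 a i.
have uS i' : (i' < imax)%N -> u i'.+1 =
    shift_exp (eta k).+1 (nu k) Delta *m (u i' + (Delta * b i') *: delta_mx ord_max ord0).
  move=> lt_i'; apply/colP => l; rewrite !mxE (@meanS (Ordinal lt_i')).
  apply: eq_bigr => l' _; rewrite !mxE andbT; case: eqP => _; rewrite ?mulr1 ?mulr0 //.
have u0 a : u 0%N = v a 0%N.
  rewrite /v constantly_forced0; apply/colP => l; rewrite mxE /mean /x.
  by under eq_Rintegral do rewrite hX.1;
    rewrite Rintegral_cst // [X in fine X]probability_setT mulr1.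
have b_le i' : (i' < imax)%N ->
    Num.min 0 (c k * fmax (ordS k)) <= b i' <= Num.max 0 (c k * fmax (ordS k)).
  move=> lt_i'; have /andP[f0 fle] := fx_integral_bounds k (ltnW lt_i').
  (* The sign of [c k] decides on which side of 0 the forcing lies. *)
  rewrite ge_min le_max /b; have [c0|c0] := leP 0 (c k).
    by rewrite (mulr_ge0 c0 f0) (ler_wpM2l c0 fle) orbT.
  by rewrite (mulr_le0_ge0 (ltW c0) f0) (ler_wnM2l (ltW c0) fle) orbT.
have -> : mean i j = u i j ord0 by rewrite mxE.
apply/andP; split.
  (* The summand [l = 0] separating [mean_bound] from [v] is nonpositive for [Num.min], so it only
     lowers the bound. Its power of 0 is 1 in the last coordinate and 0 elsewhere. *)
  apply: (@le_trans _ _ (v (Num.min 0 (c k * fmax (ordS k))) i j ord0)).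
    rewrite mean_boundE ?gerDl => [|y m m0]; last by rewrite minr_pMl ?mul0r ?invr_ge0 ?ltW.
    rewrite mulr_ge0_le0 // mulr_ge0_le0 ?ge_min ?lexx //.
    by rewrite mulr_ge0 ?expR_ge0 // exprn_ge0 // mul0r.
  apply: (forced_recursion_le Delta0 _ uS (esym (u0 _)) _ le_i j
      (a := fun=> Num.min 0 (c k * fmax (ordS k)))).
    by move=> i' _; exact: constantly_forcedS.
  by move=> i' /b_le/andP[].
(* For [Num.max] the same summand is nonnegative and only raises the upper bound. *)
apply: (@le_trans _ _ (v (Num.max 0 (c k * fmax (ordS k))) i j ord0)).
  apply: (forced_recursion_le Delta0 uS _ (u0 _) _ le_i j
      (b := fun=> Num.max 0 (c k * fmax (ordS k)))).
    by move=> i' _; exact: constantly_forcedS.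
  by move=> i' /b_le/andP[].
rewrite mean_boundE ?lerDl => [|y m m0]; last by rewrite maxr_pMl ?mul0r ?invr_ge0 ?ltW.
rewrite mulr_ge0 // mulr_ge0 ?le_max ?lexx //.
by rewrite mulr_ge0 ?expR_ge0 // exprn_ge0 // mul0r.
Qed.

End moments.

Theorem theorem6 (R : realType) (d : measure_display) (T : measurableType d)
    (P : probability T R)
    (eta : 'I_2 -> nat) (nu c p fmax : 'I_2 -> R) (N : nat)
    (f : 'I_2 -> R -> R) (Delta : R) (x0 : 'cV[R]_(kappa eta)) (imax : nat)
    (xi : 'I_imax -> {RV P >-> (R * R)%type})
    (X : nat -> T -> 'cV[R]_(kappa eta))
    (heta : forall k, (1 <= eta k)%N)
    (hnu : forall k, 0 < nu k)
    (hc : forall k, c k = -1 \/ c k = 1)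
    (hN : (1 <= N)%N)
    (hp : forall k, 0 < p k)
    (hp1 : \sum_(k < 2) p k = 1)
    (hf : assumptionA f fmax)
    (hDelta : 0 < Delta)
    (hxi_normal : forall i, standard_normal2 (xi i))
    (hxi_indep : independent_RVs xi)
    (hX : lie_trotter_scheme nu c p N f Delta x0 xi X) :
  forall (i : nat) (k : 'I_2) (j : 'I_(eta k).+1), (i <= imax)%N ->
    ((mean_bound Num.min nu c fmax Delta x0 i j)%:E
       <= 'E_P[fun w => block_coord (X i w) j]
       <= (mean_bound Num.max nu c fmax Delta x0 i j)%:E)%E.
Proof.
move=> i k j le_i.
rewrite (block_coord_mean hf hxi_normal hxi_indep hX) // !lee_fin.
exact: (mean_bounds hf hxi_normal hxi_indep hX _ (ltW hDelta)).
Qed.
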